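(* Let $(C_n)_\phi$ be any signed cycle on $n$ vertices (with any vertex as sink). Then the critical group satisfies $\mathcal{K}((C_n)_\phi)\cong\mathbb{Z}_n$.
   Context: A signed graph $G_\phi$ is a finite simple graph $G=(V,E)$ with a sign function $\phi:E\to\{+,-\}$. $C_n$ ($n\ge 3$) is the cycle graph on $n$ vertices. For a signed graph with $N$ nonsink vertices $v_1,\dots,v_N$ and sink $q$, the reduced signed Laplacian $L_{G_\phi}$ is the $N\times N$ matrix with diagonal entries $\deg_G(v_i)$ (counting edges to $q$) and, for $i\neq j$, $(i,j)$ entry $-1$ if $v_iv_j$ is a positive edge, $+1$ if it is a negative edge, $0$ if it is not an edge. The critical group is $\mathcal{K}(G_\phi)=\mathbb{Z}^N/\mathrm{im}\,L_{G_\phi}$ (for $C_n$, $N=n-1$). $\mathbb{Z}_k$ denotes $\mathbb{Z}/k\mathbb{Z}$. *)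

(* Defs.v *)
From HB Require Import structures.
From mathcomp Require Import all_boot all_order all_algebra.
From mathcomp Require Import ring_quotient boolp.

Set Implicit Arguments.
Unset Strict Implicit.
Unset Printing Implicit Defensive.

Import GRing.Theory.
Local Open Scope ring_scope.

Record sgraph (V : finType) := SGraph {
  adj :> rel V;
  adj_sym : symmetric adj;
  adj_irr : irreflexive adj
}.

Definition edges (V : finType) (G : sgraph V) : {set {set V}} :=
  [set [set p.1; p.2] | p : V * V & adj G p.1 p.2].

Definition deg (V : finType) (G : sgraph V) (v : V) : nat :=
  #|[set w | adj G v w]|.

Inductive sign := Pos | Neg.

Definition signing (V : finType) (G : sgraph V) :=
  {e : {set V} | e \in edges G} -> sign.

Section CriticalGroup.

Variables (V : finType) (G : sgraph V) (phi : signing G) (q : V).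

Definition nonsinks : {set V} := [set~ q].

(* Nonsink vertices are numbered by the standard enumeration of the vertex
   type; [insub] yields [None] exactly when the pair is not an edge of G. *)
Definition reduced_signed_laplacian : 'M[int]_#|nonsinks| :=
  \matrix_(i, j)
    let u := enum_val i in
    let v := enum_val j in
    if i == j then (deg G u)%:Z
    else match insub [set u; v] with
         | Some e => match phi e with Pos => -1 | Neg => 1 end
         | None => 0
         end.

End CriticalGroup.

(* Membership in the subgroup im A of Z^m, as a classical boolean so that
   Z^m / im A can be formed with the library quotient. *)
Definition im_mx (m n : nat) (A : 'M[int]_(m, n)) : {pred 'cV[int]_m} :=
  fun y => `[< exists x : 'cV[int]_n, y = A *m x >].

Lemma im_mx_zmod_closed (m n : nat) (A : 'M[int]_(m, n)) :
  zmod_closed (im_mx A).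
Proof.
split; first by apply/asboolP; exists 0; rewrite mulmx0.
move=> _ _ /asboolP[x ->] /asboolP[y ->].
by apply/asboolP; exists (x - y); rewrite mulmxBr.
Qed.

HB.instance Definition _ (m n : nat) (A : 'M[int]_(m, n)) :=
  GRing.isZmodClosed.Build 'cV[int]_m (im_mx A) (im_mx_zmod_closed A).

Definition critical_group (V : finType) (G : sgraph V) (phi : signing G)
    (q : V) : zmodType :=
  Quotient.quot (im_mx (reduced_signed_laplacian phi q)).

Definition zmod_isomorphic (A B : zmodType) : Prop :=
  exists f : {additive A -> B}, bijective f.

(* [ordS] is the successor modulo n; the clause [i != j] only matters for
   n = 1, where it keeps the relation irreflexive. *)
Definition cycle_adj (n : nat) : rel 'I_n :=
  fun i j => (i != j) && ((j == ordS i) || (i == ordS j)).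

Lemma cycle_adj_sym (n : nat) : symmetric (@cycle_adj n).
Proof. by move=> i j; rewrite /cycle_adj eq_sym orbC. Qed.

Lemma cycle_adj_irr (n : nat) : irreflexive (@cycle_adj n).
Proof. by move=> i; rewrite /cycle_adj eqxx. Qed.

Definition cycle_graph (n : nat) : sgraph 'I_n :=
  SGraph (@cycle_adj_sym n) (@cycle_adj_irr n).

(* Main.v *)
Require Import Defs.
From HB Require Import structures.
From mathcomp Require Import all_boot all_order all_algebra.
From mathcomp Require Import ring_quotient boolp zify ring.

Set Implicit Arguments.
Unset Strict Implicit.
Unset Printing Implicit Defensive.

Import GRing.Theory.
Local Open Scope ring_scope.
Local Open Scope quotient_scope.

(** Walk around the cycle from the sink [q], through the vertices [walk 0 = q],
    [walk 1], ..., [walk n = q]. Deleting the sink leaves a path, and a path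
    contains no cycle along which the product of the signs could be an
    obstruction: multiplying the coordinate at [walk k] by a suitable unit
    [switching k = +1 or -1] turns every off-diagonal entry of the reduced
    Laplacian into -1. This is an automorphism of the lattice, so the signs
    do not affect the cokernel.

    In the switched coordinates [z k] (with [z 0 = z n = 0] at the sink) the
    Laplacian is the second difference [2 z k - z (k-1) - z (k+1)], see
    [along_laplacian]. The linear form that separates its image is the moment
    [sum_k k * w k]:
    - summing by parts, the moment of a second difference is [n * z (n-1)]
      ([sum_second_difference]), so the image has moment divisible by [n];
    - conversely, a vector whose moment is [n * c] is the second difference of
      an explicit [z] vanishing at both ends ([dirichlet_path]); divisibility
      of the moment is exactly what lets the initial slope be an integer.
    Hence the image is the kernel of the moment modulo [n]
    ([im_laplacianP]). The moment takes every integer value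
    ([moment_surj]), so by the first isomorphism theorem
    ([quot_im_mx_isomorphic]) it induces the isomorphism onto ['Z_n]. *)

(** * Quotients and residues *)

(** First isomorphism theorem. The induced map is [f] of the chosen
    representative, and its inverse is the class of a chosen preimage. *)
Lemma quot_im_mx_isomorphic (m n : nat) (A : 'M[int]_(m, n)) (B : zmodType)
    (f : {additive 'cV[int]_m -> B}) :
  (forall y, f y = 0 <-> exists x, y = A *m x) ->
  (forall b, exists y, f y = b) ->
  zmod_isomorphic (Quotient.quot (im_mx A)) B.
Proof.
move=> kerf surjf; pose Q := Quotient.quot (im_mx A).
have pi_eq y z : \pi_Q y = \pi_Q z :> Q <-> f y = f z.
  split=> [/eqP | fyz].
    rewrite -Quotient.idealrBE => /asboolP/kerf/eqP.
    by rewrite raddfB subr_eq0 => /eqP.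
  apply/eqP; rewrite -Quotient.idealrBE; apply/asboolP/kerf.
  by rewrite raddfB fyz subrr.
pose g (c : Q) := f (repr c).
have g_pi y : g (\pi_Q y) = f y by apply/pi_eq; rewrite reprK.
have gB : zmod_morphism g.
  by move=> c d; rewrite -[c]reprK -[d]reprK -raddfB /= !g_pi raddfB.
pose gM := GRing.isZmodMorphism.Build _ _ g gB.
pose gA : {additive Q -> B} := HB.pack g gM.
exists gA; have [s sK] := choice surjf.
exists (fun b => \pi_Q (s b)) => [c | b] /=; last by rewrite g_pi sK.
by rewrite -[RHS]reprK; apply/pi_eq; rewrite sK.
Qed.

Lemma intr_Zp_eq0 (n : nat) (m : int) : (1 < n)%N ->
  (m%:~R : 'Z_n) = 0 <-> exists c : int, m = n%:Z * c.
Proof.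
move=> n_gt1; have n0 : (n%:Z)%:~R = 0 :> 'Z_n by rewrite -pmulrn pchar_Zp.
split=> [m0 | [c ->]]; last by rewrite intrM n0 mul0r.
exists (m %/ n)%Z; rewrite mulrC {1}(divz_eq m n).
have [r def_r r_lt] : exists2 r : nat, (m %% n)%Z = r & (r < n)%N.
  have := modz_ge0 m (d := n); have := ltz_mod m (d := n).
  case: (m %% n)%Z => [r|r] => [H _ | _ H]; last by lia.
  by exists r; lia.
move: m0; rewrite {1}(divz_eq m n) intrD intrM n0 mulr0 add0r def_r -pmulrn.
move/(congr1 val); rewrite /= val_Zp_nat // modn_small // => ->.
by rewrite addr0.
Qed.

(** * Second differences on a path *)

(** Summation by parts: the second difference of [k] itself is 0, so only
    boundary terms survive. *)
Lemma sum_second_difference (z d : nat -> int) (n : nat) : (0 < n)%N ->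
  (forall k, (k.+1 < n)%N -> d k.+1 = 2 * z k.+1 - z k - z k.+2) ->
  \sum_(k < n) k%:Z * d k = n%:Z * z n.-1 - n.-1%:Z * z n - z 0%N.
Proof.
case: n => // n _; elim: n => [|n IHn] dE; first by rewrite big_ord1 /=; ring.
rewrite big_ord_recr /= IHn => [|k k_lt]; last by apply: dE; lia.
rewrite dE //= !intS; ring.
Qed.

(** Solving the recurrence from [z 0 = 0] with slope [t] gives
    [z k = k t - sum_(j < k) (k - j) w j]. At [k = n] the sum is
    [n (sum_j w j) - n c], so [z n = 0] is solved by the integer
    [t = sum_j w j - c]. *)
Lemma dirichlet_path (n : nat) (w : nat -> int) (c : int) :
  \sum_(k < n) k%:Z * w k = n%:Z * c ->
  exists z : nat -> int,
    [/\ z 0%N = 0, z n = 0 &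
        forall k, 2 * z k.+1 - z k - z k.+2 = w k.+1].
Proof.
move=> sum_w; pose t := \sum_(j < n) w j - c.
pose z k : int := k%:Z * t - \sum_(j < k) (k%:Z - j%:Z) * w j.
have sumE k : \sum_(j < k) (k%:Z - j%:Z) * w j =
    k%:Z * (\sum_(j < k) w j) - \sum_(j < k) j%:Z * w j.
  by rewrite mulr_sumr -sumrB; apply: eq_bigr => j _; rewrite mulrBl.
exists z; split=> [||k].
- by rewrite /z big_ord0; ring.
- by rewrite /z sumE sum_w /t; ring.
- by rewrite /z !sumE !big_ord_recr /= !intS; ring.
Qed.

(** * Weights of edges *)

Section EdgeWeight.

Variables (V : finType) (G : sgraph V) (phi : signing G).

(** The off-diagonal entries of the signed Laplacian, indexed by vertices
    rather than by their ranks among the nonsink vertices. *)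
Definition edge_weight (u v : V) : int :=
  match insub [set u; v] with
  | Some e => match phi e with Pos => -1 | Neg => 1 end
  | None => 0
  end.

Lemma edge_weight_sym u v : edge_weight u v = edge_weight v u.
Proof. by rewrite /edge_weight setUC. Qed.

(** An edge is stored as the image of an ordered pair, so the preimage may be
    either orientation; symmetry of adjacency reconciles the two. *)
Lemma mem_edges u v : ([set u; v] \in edges G) = adj G u v.
Proof.
apply/imsetP/idP => [[[a b]] | uv]; last by exists (u, v); rewrite ?inE.
rewrite inE /= => ab /setP uv_ab.
have := uv_ab a; have := uv_ab b; rewrite !inE !eqxx ?orbT /=.
move=> /orP[]/eqP bE /orP[]/eqP aE; move: ab; rewrite aE bE ?adj_irr //.
by rewrite adj_sym.
Qed.

Lemma edge_weight_adj u v : adj G u v -> edge_weight u v ^+ 2 = 1.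
Proof.
rewrite -mem_edges /edge_weight => uv; rewrite insubT.
by case: (phi _).
Qed.

Lemma edge_weight_nonadj u v : ~~ adj G u v -> edge_weight u v = 0.
Proof. by rewrite -mem_edges => uv; rewrite /edge_weight insubN. Qed.

End EdgeWeight.

(** * Vectors indexed by the nonsink vertices *)

Section ExtendByZero.

Variables (V : finType) (q : V).

(** The value at the sink is an empty sum, so this is extension by 0. *)
Definition extend0 (y : 'cV[int]_#|nonsinks q|) (v : V) : int :=
  \sum_(i | enum_val i == v) y i 0.

Lemma extend0_sink y : extend0 y q = 0.
Proof.
rewrite /extend0 big_pred0 // => i; apply: contraTF (enum_valP i) => /eqP ->.
by rewrite !inE eqxx.
Qed.

Lemma extend0_enum_val y i : extend0 y (enum_val i) = y i 0.
Proof.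
by rewrite /extend0 (big_pred1 i) // => j; rewrite (inj_eq enum_val_inj).
Qed.

Lemma extend0B y z v : extend0 (y - z) v = extend0 y v - extend0 z v.
Proof. by rewrite -sumrB; apply: eq_bigr => i _; rewrite !mxE. Qed.

Lemma enum_val_nonsink v : v != q ->
  exists i : 'I_#|nonsinks q|, enum_val i = v.
Proof.
move=> v_q; have vP : v \in nonsinks q by rewrite !inE.
by exists (enum_rank_in vP v); rewrite enum_rankK_in.
Qed.

Lemma extend0_col (F : V -> int) v : v != q ->
  extend0 (\col_i F (enum_val i)) v = F v.
Proof. by move=> /enum_val_nonsink[i <-]; rewrite extend0_enum_val mxE. Qed.

(** Extension by 0 makes the deleted column of the sink contribute nothing, so
    a row of the reduced matrix acts as a sum over all neighbours of [v]. *)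
Lemma extend0_laplacian (G : sgraph V) (phi : signing G) x v : v != q ->
  extend0 (reduced_signed_laplacian phi q *m x) v =
  (deg G v)%:Z * extend0 x v
    + \sum_(u | adj G v u) edge_weight phi v u * extend0 x u.
Proof.
move=> /enum_val_nonsink[i <-]; rewrite extend0_enum_val mxE.
pose F u := (if enum_val i == u then (deg G (enum_val i))%:Z
             else edge_weight phi (enum_val i) u) * extend0 x u.
transitivity (\sum_(u in nonsinks q) F u).
  rewrite [RHS]big_enum_val; apply: eq_bigr => j _.
  by rewrite mxE /F extend0_enum_val (inj_eq enum_val_inj).
transitivity (\sum_u F u).
  rewrite [RHS](bigID (mem (nonsinks q))) /= [X in _ + X]big1 ?addr0 // => u.
  by rewrite !inE negbK => /eqP->; rewrite /F extend0_sink mulr0.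
rewrite (bigD1 (enum_val i)) //= /F eqxx; congr (_ + _).
rewrite big_mkcond [RHS]big_mkcond; apply: eq_bigr => u _.
rewrite eq_sym; have [<-|_] := eqVneq; first by rewrite adj_irr.
by case: ifPn => // /edge_weight_nonadj ->; rewrite mul0r.
Qed.

End ExtendByZero.

(** * The cycle as a closed walk from the sink *)

Section Cycle.

Variables (n : nat) (hn : (2 < n)%N) (phi : signing (cycle_graph n)).
Variable q : 'I_n.

Definition walk (k : nat) : 'I_n := iter k (@ordS n) q.

Lemma val_walk k : walk k = ((q + k) %% n)%N :> nat.
Proof.
elim: k => [|k IHk]; first by rewrite addn0 modn_small.
by rewrite /= IHk -addn1 modnDml addn1 addnS.
Qed.

Lemma walk_closed : walk n = q.
Proof. by apply: val_inj; rewrite /= val_walk modnDr modn_small. Qed.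

Lemma walk_inj : {in gtn n &, injective walk}.
Proof.
move=> j k; rewrite !inE => j_lt k_lt /(congr1 val) /eqP.
by rewrite /= !val_walk eqn_modDl !modn_small // => /eqP.
Qed.

Lemma walk_surj v : exists2 k, (k < n)%N & walk k = v.
Proof.
have wI : injective (fun k : 'I_n => walk k).
  by move=> j k /(walk_inj (ltn_ord j) (ltn_ord k)) /val_inj.
have [g _ gK] := injF_bij wI.
by exists (g v).
Qed.

Lemma walk_nonsink k : (0 < k < n)%N -> walk k != q.
Proof.
move=> /andP[k_gt0 k_lt]; apply/eqP => /(@walk_inj k 0%N); rewrite !inE k_lt.
by move=> /(_ isT (ltn_trans (isT : 0 < 2)%N hn)) k0; rewrite k0 in k_gt0.
Qed.

Lemma cycle_adj_walkS k v :
  cycle_adj (walk k.+1) v = (v \in [set walk k; walk k.+2]).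
Proof.
have ordS_neq (u : 'I_n) : u != ordS u.
  apply/eqP => /(congr1 val)/eqP/=.
  rewrite -[X in X == _](modn_small (ltn_ord u)).
  rewrite -addn1 -[X in (X == _ %[mod _])%N]addn0 eqn_modDl.
  by rewrite !modn_small //; lia.
rewrite /cycle_adj !inE orbC (eq_sym _ (ordS v)) (inj_eq (@ordS_inj n)).
apply: andb_idl => /orP[]/eqP->; last exact: ordS_neq.
by rewrite eq_sym ordS_neq.
Qed.

(** This is where simplicity of the cycle enters: for [n = 2] the two
    neighbours of a vertex would coincide and degrees would drop to 1. *)
Lemma walk_neq2 k : walk k != walk k.+2.
Proof.
apply/eqP => /(congr1 (@nat_of_ord n))/eqP; rewrite !val_walk -addn2 addnA.
by rewrite -[X in (X == _ %[mod _])%N]addn0 eqn_modDl !modn_small //; lia.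
Qed.

Lemma deg_cycle k : deg (cycle_graph n) (walk k.+1) = 2%N.
Proof.
rewrite /deg -(_ : [set walk k; walk k.+2] = [set _ | _]) ?cards2 ?walk_neq2 //.
by apply/setP=> v; rewrite [RHS]inE /= cycle_adj_walkS.
Qed.

(** The recursion is solved for
    [switching k * weight = - switching (k + 1)], which makes the conjugated
    off-diagonal entries equal to -1. *)
Fixpoint switching (k : nat) : int :=
  if k is j.+1 then - edge_weight phi (walk j) (walk j.+1) * switching j else 1.

Lemma switchingS k :
  switching k.+1 = - edge_weight phi (walk k) (walk k.+1) * switching k.
Proof. by []. Qed.

Lemma edge_weight_walk k : edge_weight phi (walk k) (walk k.+1) ^+ 2 = 1.
Proof.
apply: edge_weight_adj; rewrite adj_sym /= cycle_adj_walkS.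
by rewrite !inE eqxx.
Qed.

Lemma switching_sqr k : switching k ^+ 2 = 1.
Proof.
by elim: k => //= k IHk; rewrite exprMn sqrrN edge_weight_walk IHk mulr1.
Qed.

Lemma switchingK k (a : int) : switching k * (switching k * a) = a.
Proof. by rewrite mulrA -expr2 switching_sqr mul1r. Qed.

(** The switched coordinates in which the Laplacian of every signing is the
    same second difference. *)
Definition along (y : 'cV[int]_#|nonsinks q|) (k : nat) : int :=
  switching k * extend0 y (walk k).

(** With [w_k] the weight of the edge from [walk k] to [walk k.+1], the two
    neighbours contribute [switching k.+1 * w_k = - switching k] and
    [switching k.+1 * w_k.+1 = - switching k.+2]. For [k.+2 = n] the last term
    is at the sink and vanishes. *)
Lemma along_laplacian x k : (k.+1 < n)%N ->
  along (reduced_signed_laplacian phi q *m x) k.+1 =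
  2 * along x k.+1 - along x k - along x k.+2.
Proof.
move=> k_lt; rewrite /along extend0_laplacian ?walk_nonsink // deg_cycle.
rewrite (eq_bigl (mem [set walk k; walk k.+2])) => [|v];
  last exact: cycle_adj_walkS.
rewrite big_setU1 ?inE ?walk_neq2 // big_set1.
have -> : switching k = - edge_weight phi (walk k) (walk k.+1) * switching k.+1.
  by rewrite switchingS mulrA mulrNN -expr2 edge_weight_walk mul1r.
rewrite [switching k.+2]switchingS (edge_weight_sym _ (walk k.+1) (walk k)).
rewrite [X in _ * (_ + X)]/=; ring.
Qed.

Lemma along0 y : along y 0 = 0.
Proof. by rewrite /along extend0_sink mulr0. Qed.

Lemma alongn y : along y n = 0.
Proof. by rewrite /along walk_closed extend0_sink mulr0. Qed.

Lemma along_inj y z :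
  (forall k, (k.+1 < n)%N -> along y k.+1 = along z k.+1) -> y = z.
Proof.
move=> yz; apply/colP=> i; rewrite -!extend0_enum_val.
have [[|k] k_lt <-] := walk_surj (enum_val i); first by rewrite !extend0_sink.
rewrite -(switchingK k.+1 (extend0 y _)) -[LHS]/(_ * along y _).
by rewrite yz ?switchingK.
Qed.

Lemma along_surj (z : nat -> int) : z 0%N = 0 -> z n = 0 ->
  exists x, forall k, (k <= n)%N -> along x k = z k.
Proof.
move=> z0 zn.
have /choice[g gP] v : exists k, (k < n)%N /\ walk k = v.
  by have [k] := walk_surj v; exists k.
exists (\col_i (switching (g (enum_val i)) * z (g (enum_val i)))) => k.
rewrite leq_eqVlt => /orP[/eqP-> | k_lt]; first by rewrite alongn zn.
case: k k_lt => [|k] k_lt; first by rewrite along0 z0.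
rewrite /along (extend0_col (fun v => switching (g v) * z (g v)));
  last exact: walk_nonsink.
have [g_lt /walk_inj->] := gP (walk k.+1); rewrite ?inE //.
exact: switchingK.
Qed.

Definition moment (y : 'cV[int]_#|nonsinks q|) : int :=
  \sum_(k < n) k%:Z * along y k.

Lemma momentB y z : moment (y - z) = moment y - moment z.
Proof.
by rewrite -sumrB; apply: eq_bigr => k _; rewrite /along extend0B; ring.
Qed.

(** Summation by parts gives one direction; for the other, the solution of the
    second-difference equation vanishes at both ends of the walk, so it does
    come from a vector on the nonsink vertices. *)
Lemma im_laplacianP y :
  (exists x, y = reduced_signed_laplacian phi q *m x) <->
  (exists c : int, moment y = n%:Z * c).
Proof.
split=> [[x ->] | [c /dirichlet_path[z [z0 zn zE]]]].
  exists (along x n.-1).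
  rewrite /moment (sum_second_difference (z := along x)) ?alongn ?along0.
  - by ring.
  - by lia.
  - exact: along_laplacian.
have [x xE] := along_surj z0 zn.
exists x; apply: along_inj => k k_lt.
by rewrite along_laplacian // -zE !xE //; lia.
Qed.

Lemma moment_surj (c : int) : exists y, moment y = c.
Proof.
(* The first vertex after the sink has weight 1 in the moment, so [c] placed
   there and 0 elsewhere will do. *)
have [||y yE] := @along_surj (fun k => if k == 1%N then c else 0) => //.
  by rewrite ifN //; lia.
exists y; have n_gt1 : (1 < n)%N by lia.
rewrite /moment (bigD1 (Ordinal n_gt1)) //= big1 => [|k k_neq1].
  by rewrite addr0 yE //=; [ring | lia].
by rewrite yE 1?ltnW // ifN ?mulr0.
Qed.

End Cycle.

Local Close Scope ring_scope.

Theorem proposition4p4 (n : nat) (hn : 2 < n)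
    (phi : signing (cycle_graph n)) (q : 'I_n) :
  zmod_isomorphic (critical_group phi q) 'Z_n.
Proof.
have n_gt1 := ltnW hn.
pose f (y : 'cV[int]_#|nonsinks q|) : 'Z_n := (moment phi y)%:~R%R.
have fB : zmod_morphism f by move=> y z; rewrite /f momentB intrB.
pose fM := GRing.isZmodMorphism.Build _ _ f fB.
pose fA : {additive 'cV[int]_#|nonsinks q| -> 'Z_n} := HB.pack f fM.
apply: (quot_im_mx_isomorphic (f := fA)) => [y | b].
  by rewrite /= /f intr_Zp_eq0 // im_laplacianP.
have [y yE] := moment_surj hn phi q b.
by exists y; rewrite /= /f yE -pmulrn natr_Zp.
Qed.
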